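(* Let $\|\cdot\|_1$ and $\|\cdot\|_2$ be norms on $\mathbb{C}^n$. The generalized induced norm $\|\cdot\|_{1,2}$ on $M_n$ is unitarily invariant if and only if both $\|\cdot\|_1$ and $\|\cdot\|_2$ are unitarily invariant.
   Context: $M_n$ denotes the complex algebra of all $n\times n$ matrices over $\mathbb{C}$. Given norms $\|\cdot\|_1,\|\cdot\|_2$ on $\mathbb{C}^n$, the generalized induced (g-ind) norm via $\|\cdot\|_1$ and $\|\cdot\|_2$ is the norm on $M_n$ defined by $\|A\|_{1,2}=\max\{\|Ax\|_2:\|x\|_1=1\}$. A norm $\|\cdot\|$ on $\mathbb{C}^n$ is unitarily invariant if $\|Ux\|=\|x\|$ for all unitary $U\in M_n$ and all $x\in\mathbb{C}^n$. A norm $\|\cdot\|$ on $M_n$ is unitarily invariant if $\|UAV\|=\|A\|$ for all unitary $U,V\in M_n$ and all $A\in M_n$. *)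

(* Defs.v *)
From mathcomp Require Import all_boot all_order all_algebra.
From mathcomp Require Import complex.
From mathcomp Require Import all_classical all_reals all_analysis.

Set Implicit Arguments.
Unset Strict Implicit.
Unset Printing Implicit Defensive.

Import Order.TTheory GRing.Theory Num.Theory.
Import numFieldNormedType.Exports.
Import Normc.

Local Open Scope classical_set_scope.
Local Open Scope ring_scope.
Local Open Scope complex_scope.

(* [normc z] is the modulus of [z : R[i]] as an element of [R]; the generic
   [`|z|] lives in [R[i]]. *)
Definition is_vnorm (R : realType) (V : lmodType R[i]) (N : V -> R) : Prop :=
  [/\ forall x, 0 <= N x,
      forall x, N x = 0 -> x = 0,
      forall (a : R[i]) x, N (a *: x) = normc a * N x &
      forall x y, N (x + y) <= N x + N y].

(* The supremum is a maximum when N1 and N2 are norms and 0 < n: see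
   [gind_norm_max]. *)
Definition gind_norm (R : realType) (n : nat) (N1 N2 : 'cV[R[i]]_n -> R)
    (A : 'M[R[i]]_n) : R :=
  sup [set N2 (A *m x) | x in [set x | N1 x = 1]].

Definition unitarily_invariant_cV (R : realType) (n : nat)
    (N : 'cV[R[i]]_n -> R) : Prop :=
  forall (U : 'M[R[i]]_n) (x : 'cV[R[i]]_n),
    U \is unitarymx -> N (U *m x) = N x.

Definition unitarily_invariant_mx (R : realType) (n : nat)
    (N : 'M[R[i]]_n -> R) : Prop :=
  forall U V A : 'M[R[i]]_n,
    U \is unitarymx -> V \is unitarymx -> N (U *m A *m V) = N A.

Section GindMax.
Variables (R : realType) (n : nat).
Implicit Types p N : 'cV[R[i]]_n -> R.

Let C_of (v : 'rV[R]_(n + n)) : 'cV[R[i]]_n :=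
  \col_i (v 0 (lshift n i) +i* v 0 (rshift n i)).

Let C_ofB v w : C_of (v - w) = C_of v - C_of w.
Proof. by apply/colP => i; rewrite !mxE. Qed.

Let C_ofZ (a : R) v : C_of (a *: v) = a%:C *: C_of v.
Proof. by apply/colP => i; rewrite !mxE; simpc. Qed.

Let C_of_surj x : exists v, C_of v = x.
Proof.
exists (row_mx (\row_i complex.Re (x i 0)) (\row_i complex.Im (x i 0))).
by apply/colP => i; rewrite mxE row_mxEl row_mxEr !mxE; case: (x i 0).
Qed.

Let C_of_inj0 v : C_of v = 0 -> v = 0.
Proof.
move=> v0; apply/rowP => k; rewrite mxE -(splitK k).
by case: (fintype.split k) => i /=; move/colP/(_ i): v0; rewrite !mxE => -[].
Qed.

Let normc_real (a : R) : normc a%:C = `|a|.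
Proof. by rewrite /normc /= expr0n addr0 sqrtr_sqr. Qed.

Let semi p := (forall (a : R[i]) x, p (a *: x) = normc a * p x) /\
              (forall x y, p (x + y) <= p x + p y).

Let semi_ge0 p : semi p -> forall x, 0 <= p x.
Proof.
move=> [pZ pD] x.
have p0 : p 0 = 0 by rewrite -(scale0r 0) pZ normc0 mul0r.
have pN : p (- x) = p x by rewrite -scaleN1r pZ normcN normc1 mul1r.
by have := pD x (- x); rewrite subrr p0 pN -mulr2n pmulrn_lge0.
Qed.

Let semi_cont p : semi p -> continuous (p \o C_of).
Proof.
move=> sp; have p_ge0 := semi_ge0 sp; case: sp => pZ pD.
have p0 : p 0 = 0 by rewrite -(scale0r 0) pZ normc0 mul0r.
have pN x : p (- x) = p x by rewrite -scaleN1r pZ normcN normc1 mul1r.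
have psum (I : finType) (F : I -> 'cV[R[i]]_n) : p (\sum_i F i) <= \sum_i p (F i).
  elim/big_ind2 : _ => //; first by rewrite p0.
  by move=> a b c d ab cd; rewrite (le_trans (pD _ _))// lerD.
pose d i : 'cV[R[i]]_n := delta_mx i 0.
pose K := \sum_i (p (d i) + p ('i *: d i)) + 1.
have K_gt0 : 0 < K by rewrite ltr_wpDl// sumr_ge0// => i _; rewrite addr_ge0.
have bnd v : p (C_of v) <= K * `|v|.
  have -> : C_of v = \sum_i ((v 0 (lshift n i))%:C *: d i
                             + (v 0 (rshift n i))%:C *: ('i *: d i)).
    apply/colP => j; rewrite summxE (bigD1 j)//= big1 ?addr0.
      by rewrite !mxE !eqxx; simpc.
    by move=> i ij; rewrite !mxE eq_sym (negbTE ij) /= !mulr0 addr0.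
  rewrite (le_trans (psum _ _))// mulrDl mul1r ler_wpDr// mulr_suml ler_sum// => i _.
  have le_v k : `|v 0 k| <= `|v|.
    rewrite [leRHS]/Num.norm /= mx_normrE.
    exact: (@le_bigmax _ _ _ 0 (fun ij : 'I_1 * 'I_(n + n) => `|v ij.1 ij.2|) (0, k)).
  by rewrite (le_trans (pD _ _))// 2!pZ !normc_real mulrDl lerD// mulrC ler_wpM2l.
move=> v; apply/(@cvgrPdist_lt _ _ _ _ (nbhs_filter v)) => e e0.
apply: (@filterS _ (nbhs v) _ (ball v (K^-1 * e))) => [w|]; last first.
  by apply: nbhsx_ballx; rewrite mulr_gt0 ?invr_gt0.
rewrite -ball_normE /= => vw; apply: (@le_lt_trans _ _ (K * `|v - w|)).
  apply: le_trans (bnd _); rewrite /= C_ofB ler_norml.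
  have h x y : p x - p y <= p (x - y) by rewrite lerBlDr -{1}(subrK y x) pD.
  by rewrite h andbT lerNl opprB -(pN (_ - _)) opprB h.
by rewrite -ltr_pdivlMl.
Qed.

Lemma gind_norm_max N1 N2 (A : 'M[R[i]]_n) : (0 < n)%N ->
  is_vnorm N1 -> is_vnorm N2 ->
  (exists2 x, N1 x = 1 & N2 (A *m x) = gind_norm N1 N2 A) /\
  (forall x, N1 x = 1 -> N2 (A *m x) <= gind_norm N1 N2 A).
Proof.
move=> n0 [N1ge0 N10 N1Z N1D] [N2ge0 N20 N2Z N2D].
have c1 := semi_cont (conj N1Z N1D : semi N1).
have s2 : semi (fun x => N2 (A *m x)).
  by split=> [a x|x y]; [rewrite -scalemxAr N2Z|rewrite mulmxDr N2D].
have c2 := semi_cont s2.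
have ex1 : exists v : 'rV[R]_(n + n), `|v| = 1.
  exists (const_mx 1); rewrite [LHS]/Num.norm /= mx_normrE.
  apply/eqP; rewrite eq_le; apply/andP; split.
    by apply/bigmax_leP; split=> // ij _; rewrite mxE normr1.
  apply/bigmax_geP; right; exists (0, lshift n (Ordinal n0)) => //=.
  by rewrite mxE normr1.
pose S := [set v : 'rV[R]_(n + n) | `|v| = 1].
have cS : compact S.
  apply: bounded_closed_compact.
    exists 1; split=> // M M1 v Sv; rewrite /= Sv; exact: ltW.
  have /continuous_closedP/(_ [set 1]) := @norm_continuous R 'rV[R]_(n + n).
  by apply; exact: closed_eq.
have [v0 Sv0 minv0] := compact_EVT_min ex1 cS (continuous_subspaceT c1).
have m_gt0 : 0 < N1 (C_of v0).
  rewrite lt_neqAle N1ge0 andbT eq_sym; apply/eqP => /N10/C_of_inj0 v00.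
  by move: Sv0; rewrite inE /S /= v00 normr0 => /eqP; rewrite eq_sym oner_eq0.
pose T := [set v | N1 (C_of v) = 1].
have N1CZ (a : R) v : N1 (C_of (a *: v)) = `|a| * N1 (C_of v).
  by rewrite C_ofZ N1Z normc_real.
have cT : compact T.
  apply: bounded_closed_compact.
    exists (N1 (C_of v0))^-1; split; [exact: num_real|move=> M M1 v Tv].
    rewrite /= (le_trans _ (ltW M1))// -[leRHS]mul1r ler_pdivlMr//.
    have [->|vn0] := eqVneq v 0; first by rewrite normr0 mul0r.
    have nv : 0 < `|v| by rewrite normr_gt0.
    have := minv0 (`|v|^-1 *: v); rewrite inE /S /= normrZ normfV normr_id.
    rewrite mulVf ?gt_eqF// => /(_ erefl).
    by rewrite N1CZ normfV normr_id Tv ler_pdivlMl.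
  by move/continuous_closedP : c1 => /(_ [set 1]); apply; exact: closed_eq.
have T0 : T !=set0.
  exists ((N1 (C_of v0))^-1 *: v0); rewrite /T /= N1CZ normfV gtr0_norm//.
  by rewrite mulVf ?gt_eqF.
have [w Tw maxw] := compact_EVT_max T0 cT (continuous_subspaceT c2).
move: Tw; rewrite inE /T /= => Tw.
have ub x : N1 x = 1 -> N2 (A *m x) <= N2 (A *m C_of w).
  by have [v <-] := C_of_surj x => Nv; apply: maxw; rewrite inE.
have -> : gind_norm N1 N2 A = N2 (A *m C_of w).
  apply/eqP; rewrite eq_le; apply/andP; split.
    apply: ge_sup; first by exists (N2 (A *m C_of w)); exists (C_of w).
    by move=> _ [x /= Nx <-]; exact: ub.
  apply: ub_le_sup; last by exists (C_of w).
  by exists (N2 (A *m C_of w)) => _ [x /= Nx <-]; exact: ub.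
by split=> //; exists (C_of w).
Qed.

End GindMax.

(* Main.v *)
Require Import Defs.
From mathcomp Require Import all_boot all_order all_algebra.
From mathcomp Require Import complex.
From mathcomp Require Import all_classical all_reals all_analysis.
From mathcomp Require Import ring.

(** For a column u and a row f, the rank-one matrix u f satisfies
    |(u f) x|_2 = |f x| . |u|_2, so its g-ind norm is |u|_2 times the norm of the
    functional f dual to |.|_1.  The proof rests on the identity
    [gind_norm_rank1], valid as soon as the g-ind norm is invariant under right
    multiplication by unitary matrices:

      |f^*|_1 . ||u f||_{1,2} = |u|_2 . <f, f>,

    where < , > is the standard Hermitian product.

    Indeed let y, with |y|_1 = 1, maximize |f y|.  By invariance and because the
    unitary group acts transitively on the vectors of a given Euclidean length
    ([unitary_transitive]), every row g as long as f has the same maximum; taking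
    g proportional to y^* gives |f y|^2 >= <f, f> <y, y>.  This is the equality
    case of the Cauchy-Schwarz inequality, so y is a multiple of f^*, which
    determines |f^*|_1.  Identifying the maximizer in this way replaces the
    Hahn-Banach argument that |.|_1 is its own bidual norm.

    In this identity, replacing f by f V changes neither <f, f> nor
    ||u f||_{1,2}, hence |V^* f^*|_1 = |f^*|_1; and replacing u by U u leaves
    ||u f||_{1,2} unchanged, hence |U u|_2 = |u|_2.  The converse is a change of
    variable in the supremum defining the g-ind norm. *)

Set Implicit Arguments.
Unset Strict Implicit.
Unset Printing Implicit Defensive.

Import Order.TTheory GRing.Theory Num.Theory.
Import Normc.

Local Open Scope classical_set_scope.
Local Open Scope ring_scope.
Local Open Scope sesquilinear_scope.

Section UnitaryGroup.
Variable C : numClosedFieldType.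

Lemma mulmx_ctr n (u v : 'rV[C]_n) : u *m v ^t* = (dotmx u v)%:M.
Proof. by rewrite dotmxE -mx11_scalar. Qed.

Lemma dotmx_conj n (u v : 'rV[C]_n) : (dotmx u v)^* = dotmx v u.
Proof.
rewrite !dotmxE !mxE rmorph_sum; apply: eq_bigr => i _.
by rewrite !mxE rmorphM /= conjCK mulrC.
Qed.

(** A unitary matrix that maps f to g is the reflection-like matrix
    1 - t^-1 w^* w with w = f - g and t = <f, w>.  It is unitary because
    <w, w> = t + t^*, which is where <f, f> = <g, g> enters; keeping t complex
    makes any adjustment of the phase of g unnecessary. *)
Lemma unitary_transitive n (f g : 'rV[C]_n) : dotmx f f = dotmx g g ->
  exists2 V : 'M[C]_n, V \is unitarymx & f *m V = g.
Proof.
move=> fg; pose w := f - g; pose t := dotmx f w.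
have ww : dotmx w w = t + t^*.
  rewrite dotmx_conj /t /w linearBl /= [dotmx f _]linearBr /= [dotmx g _]linearBr /=.
  by rewrite [dotmx (f - g) f]linearBl /= fg; ring.
have [t0|tn0] := eqVneq t 0.
  exists 1%:M; first by apply/unitarymxP; rewrite trmx1 map_mx1 mulmx1.
  have /eqP : dotmx w w = 0 by rewrite ww t0 conjC0 addr0.
  by rewrite dnorm_eq0 subr_eq0 mulmx1 => /eqP.
exists (1%:M - t^-1 *: (w ^t* *m w)); last first.
  rewrite mulmxBr mulmx1 -scalemxAr mulmxA mulmx_ctr mul_scalar_mx scalerA.
  by rewrite mulVf// scale1r opprB addrC subrK.
have tcn0 : t^* != 0 by rewrite conjC_eq0.
set P := w ^t* *m w.
have PP : P *m P = (t + t^*) *: P.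
  by rewrite /P mulmxA -(mulmxA (w ^t*)) mulmx_ctr ww mul_mx_scalar -scalemxAl.
have Pc : P ^t* = P by rewrite /P trmx_mul map_mxM trmxCK.
apply/unitarymxP; rewrite [(_ - _)^T]linearB /= [(_ *: P)^T]linearZ /= map_mxB map_mxZ Pc trmx1 map_mx1.
rewrite mulmxBl mul1mx mulmxBr mulmx1 -scalemxAl -scalemxAr PP !scalerA.
rewrite fmorphV -[RHS]subr0 -addrA -opprD -scalerBl -scalerDl; congr (_ - _).
rewrite [X in X *: _](_ : _ = 0) ?scale0r//.
by field; rewrite tn0 tcn0.
Qed.

Lemma dotmx_unitary n (f : 'rV[C]_n) (V : 'M[C]_n) : V \is unitarymx ->
  dotmx (f *m V) (f *m V) = dotmx f f.
Proof. by move=> Vu; rewrite !dotmxE trmx_mul map_mxM mulmxA mulmxtVK. Qed.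

(** Only the reverse inequality is assumed: the Cauchy-Schwarz inequality then
    forces equality, hence linear dependence. *)
Lemma Cauchy_Schwarz_eq n (f h : 'rV[C]_n) : f != 0 ->
  dotmx h h * dotmx f f <= `|dotmx h f| ^+ 2 -> exists k, h = k *: f.
Proof.
move=> fn0 CS; have := CauchySchwarz (@dotmx C n) h f.
move=> /ge_leif; rewrite CS => /esym.
rewrite free_cons span_seq1 seq1_free fn0 andbT negbK => /vlineP[k ->].
by exists k.
Qed.

End UnitaryGroup.

Local Open Scope complex_scope.

Lemma unitarymx1 (C : numClosedFieldType) n : (1%:M : 'M[C]_n) \is unitarymx.
Proof. by apply/unitarymxP; rewrite trmx1 map_mx1 mulmx1. Qed.

Section GindRank1.
Variables (R : realType) (n : nat) (N1 N2 : 'cV[R[i]]_n -> R).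
Hypotheses (n_gt0 : (0 < n)%N) (hN1 : is_vnorm N1) (hN2 : is_vnorm N2).

Lemma vnorm0 (V : lmodType R[i]) (N : V -> R) : is_vnorm N -> N 0 = 0.
Proof. by case=> _ _ NZ _; rewrite -(scale0r 0) NZ normc0 mul0r. Qed.

Lemma vnorm_neq0 (V : lmodType R[i]) (N : V -> R) x :
  is_vnorm N -> x != 0 -> N x != 0.
Proof. by case=> _ N0 _ _; apply: contra_neq => /N0. Qed.

Lemma rank1_vnorm (u : 'cV[R[i]]_n) (f : 'rV_n) x :
  N2 (u *m f *m x) = normc ((f *m x) 0 0) * N2 u.
Proof.
case: hN2 => _ _ NZ _.
by rewrite -mulmxA [in LHS](mx11_scalar (f *m x)) mul_mx_scalar NZ.
Qed.

(** The vector y that maximizes |f y| subject to N1 y = 1 turns out to be a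
    multiple of f^*, so that both N1 y = 1 and the value |f y| are expressed with
    the same factor.  Stated as a product rather than as a quotient, the relation
    between them also covers u = 0 and f = 0. *)
Lemma gind_norm_rank1 (u : 'cV[R[i]]_n) (f : 'rV_n) :
  (forall (V : 'M[R[i]]_n), V \is unitarymx ->
    gind_norm N1 N2 (u *m f *m V) = gind_norm N1 N2 (u *m f)) ->
  N1 (f ^t*) * gind_norm N1 N2 (u *m f) = N2 u * normc (dotmx f f).
Proof.
move=> inv; have [[y y1 y_max] _] := gind_norm_max (u *m f) n_gt0 hN1 hN2.
have [u0|un0] := eqVneq u 0.
  by rewrite -y_max rank1_vnorm u0 (vnorm0 hN2) mulr0 mulr0 mul0r.
have [->|fn0] := eqVneq f 0.
  by rewrite trmx0 map_mx0 (vnorm0 hN1) dotmxE mul0mx mxE normc0 mul0r mulr0.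
have [h yE] : exists h : 'rV_n, y = (h ^t*) by exists (y ^t*); rewrite trmxCK.
have hn0 : h != 0.
  apply: contra_eq_neq y1 => h0.
  by rewrite yE h0 trmx0 map_mx0 (vnorm0 hN1) eq_sym oner_eq0.
have hh : 0 < dotmx h h by rewrite dnorm_gt0.
have ff : 0 < dotmx f f by rewrite dnorm_gt0.
have u_gt0 : 0 < N2 u.
  by rewrite lt_neqAle eq_sym vnorm_neq0//; case: hN2 => ->.
(* with h = y^*, the row s h is as long as f, so some unitary V moves f
   onto it; the value of u f V at y bounds from below the norm of u f, which
   is attained at y *)
pose s := sqrtC (dotmx f f / dotmx h h).
have s_ge0 : 0 <= s by rewrite sqrtC_ge0 divr_ge0// ltW.
have ssh : s ^+ 2 * dotmx h h = dotmx f f by rewrite sqrtCK divfK// gt_eqF.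
have [V Vu fV] : exists2 V : 'M[R[i]]_n, V \is unitarymx & f *m V = s *: h.
  by apply: unitary_transitive; rewrite dnormZ ger0_norm.
have : `|s * dotmx h h| <= `|dotmx f h|.
  have [_ /(_ y y1)] := gind_norm_max (u *m f *m V) n_gt0 hN1 hN2.
  rewrite inv// -y_max -(mulmxA u) fV !rank1_vnorm ler_pM2r//.
  by rewrite yE -scalemxAl !mulmx_ctr !mxE !eqxx !mulr1n -lecR.
rewrite ger0_norm => [le_fh|]; last by rewrite mulr_ge0 // ltW.
have [k hE] : exists k, h = k *: f.
  apply: Cauchy_Schwarz_eq => //.
  rewrite -ssh mulrCA -expr2 -exprMn -(dotmx_conj f h) norm_conjC.
  by rewrite lerXn2r// nnegrE mulr_ge0// ltW.
have yf : y = k^*%R *: f ^t*.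
  by rewrite yE hE [(_ *: _)^T]linearZ /= map_mxZ.
case: hN1 => _ _ N1Z _; move: y1; rewrite yf N1Z => y1.
rewrite -y_max rank1_vnorm yf -scalemxAr mulmx_ctr mxE.
rewrite [X in normc (_ * X)]mxE eqxx mulr1n normcM !mulrA (mulrC (N1 _)) y1.
by rewrite mul1r mulrC.
Qed.

End GindRank1.

Lemma gind_norm_unitary (R : realType) (n : nat) (N1 N2 : 'cV[R[i]]_n -> R) :
  unitarily_invariant_cV N1 -> unitarily_invariant_cV N2 ->
  unitarily_invariant_mx (gind_norm N1 N2).
Proof.
move=> N1U N2U U V A Uu Vu; congr (sup _); apply/seteqP; split=> _ [x /= x1 <-].
  by exists (V *m x); [rewrite /= N1U|rewrite -!mulmxA [RHS]N2U].
exists (V ^t* *m x); first by rewrite /= N1U ?trmxC_unitary.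
by rewrite -!mulmxA N2U// (mulmxA V) (unitarymxP _)// mul1mx.
Qed.

Theorem proposition2p2 (R : realType) (n : nat) (hn : (0 < n)%N)
    (N1 N2 : 'cV[R[i]]_n -> R) (hN1 : is_vnorm N1) (hN2 : is_vnorm N2) :
  unitarily_invariant_mx (gind_norm N1 N2) <->
  unitarily_invariant_cV N1 /\ unitarily_invariant_cV N2.
Proof.
split=> [inv|[]]; last exact: gind_norm_unitary.
have invr A (V : 'M[R[i]]_n) : V \is unitarymx ->
    gind_norm N1 N2 (A *m V) = gind_norm N1 N2 A.
  by move=> Vu; rewrite -[A in LHS]mul1mx inv// unitarymx1.
have invl A (U : 'M[R[i]]_n) : U \is unitarymx ->
    gind_norm N1 N2 (U *m A) = gind_norm N1 N2 A.
  by move=> Uu; rewrite -[_ *m A]mulmx1 inv// unitarymx1.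
have rank1 u f := gind_norm_rank1 hn hN1 hN2 (invr (u *m f)).
have normc_dotmx_neq0 (f : 'rV[R[i]]_n) : f != 0 -> normc (dotmx f f) != 0.
  move=> fn0; apply: contra_neq (fn0) => /eq0_normc/eqP.
  by rewrite dnorm_eq0 => /eqP.
split=> U x Uu.
- have [->|xn0] := eqVneq x 0; first by rewrite mulmx0.
  pose f : 'rV_n := x ^t*.
  have fn0 : f != 0.
    by apply: contra_neq xn0 => f0; rewrite -[x]trmxCK -/f f0 trmx0 map_mx0.
  have Uxf : U *m x = (f *m U ^t*) ^t* by rewrite trmx_mul map_mxM !trmxCK.
  have Uu' : U ^t* \is unitarymx by rewrite trmxC_unitary.
  have gind_neq0 : gind_norm N1 N2 (x *m f) != 0.
    apply/eqP => g0; have /esym/eqP := rank1 x f; rewrite g0 mulr0.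
    rewrite mulf_eq0 (negbTE (vnorm_neq0 hN2 xn0)).
    by rewrite (negbTE (normc_dotmx_neq0 _ fn0)).
  have := rank1 x (f *m U ^t*).
  rewrite dotmx_unitary// -rank1 mulmxA invr// -Uxf trmxCK.
  exact: mulIf.
- have fn0 : const_mx 1 != 0 :> 'rV[R[i]]_n.
    by apply/eqP => /rowP/(_ (Ordinal hn)); rewrite !mxE => /eqP; rewrite oner_eq0.
  apply: (mulIf (normc_dotmx_neq0 _ fn0)).
  by rewrite -!rank1 -mulmxA invl.
Qed.
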